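(* Let $X\subset\mathbb{R}^s$ be open and let the functions $f_i:X\to\mathbb{R}$ ($i=1,\dots,n$) and $g_j:X\to\mathbb{R}$ ($j=1,\dots,m$) be defined on $X$. Suppose that $\bar x$ is a weak local Pareto minimizer of problem (P), that the functions $g_j$ ($j\notin A(\bar x)$) are continuous at $\bar x$, that the functions $f_i$ ($i=1,\dots,n$) and $g_j$ ($j\in A(\bar x)$) are continuously differentiable, and that for every critical direction $d\in\mathbb{R}^s$ at $\bar x$ the functions $f_i$ ($i\in I(\bar x,d)$) and $g_j$ ($j\in J(\bar x,d)$) are second-order directionally differentiable at $\bar x$ in direction $d$. Then for every critical direction $d\in\mathbb{R}^s$ at $\bar x$ there is no $z\in\mathbb{R}^s$ which solves the system $$\nabla f_i(\bar x)z+f_i''(\bar x,d)<0,\quad i\in I(\bar x,d),$$ $$\nabla g_j(\bar x)z+g_j''(\bar x,d)<0,\quad j\in J(\bar x,d).$$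
   Context: Problem (P): minimize $f(x)$ subject to $x\in X$, $g(x)\le 0$ (componentwise), where $f=(f_1,\dots,f_n):X\to\mathbb{R}^n$, $g=(g_1,\dots,g_m):X\to\mathbb{R}^m$ and $X\subset\mathbb{R}^s$ is open. The feasible set is $S=\{x\in X: g_j(x)\le 0,\ j=1,\dots,m\}$. A point $\bar x\in S$ is a weak local Pareto minimizer if there is a neighbourhood $U$ of $\bar x$ such that no $x\in U\cap S$ satisfies $f_i(x)<f_i(\bar x)$ for all $i=1,\dots,n$. For $x\in S$, $A(x)=\{j: g_j(x)=0\}$ is the set of active constraints. A direction $d\in\mathbb{R}^s$ is critical at $x\in S$ if $\nabla f_i(x)d\le 0$ for all $i=1,\dots,n$ and $\nabla g_j(x)d\le 0$ for all $j\in A(x)$. For $d$ critical at $x$: $I(x,d)=\{i\in\{1,\dots,n\}:\nabla f_i(x)d=0\}$ and $J(x,d)=\{j\in A(x):\nabla g_j(x)d=0\}$. For $h:X\to\mathbb{R}$ differentiable at $x\in X$, the second-order directional derivative at $x$ in direction $u\in\mathbb{R}^s$ is $$h''(x,u)=\lim_{t\to+0}2t^{-2}\,[h(x+tu)-h(x)-t\nabla h(x)u].$$ $h$ is second-order directionally differentiable at $x$ in direction $u$ if this limit exists and is finite. *)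

(* Defs.v *)
From mathcomp Require Import all_boot all_order all_algebra.
From mathcomp Require Import boolp classical_sets reals topology normedtype derive.

Set Implicit Arguments.
Unset Strict Implicit.
Unset Printing Implicit Defensive.
Import Order.TTheory GRing.Theory Num.Theory.
Import numFieldNormedType.Exports.
Local Open Scope ring_scope.
Local Open Scope classical_set_scope.

(* Functions on an open set X of R^s are represented by total functions
   'rV[R]_s -> R. Every notion below is evaluated at points of X and depends
   only on values near such a point (or, for feasibility, on X), so the values
   outside X play no role. The product of the gradient of h at x with u is the
   differential 'd h x u, see diff_gradE. *)

Section Differentiability.
Context {R : realType} {s : nat}.
Implicit Types (h : 'rV[R]_s -> R) (x u : 'rV[R]_s) (X : set 'rV[R]_s).

Definition grad h x : 'rV[R]_s := \row_j 'd h x (delta_mx 0 j).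

Lemma diff_gradE h x u : 'd h x u = \sum_j grad h x 0 j * u 0 j.
Proof.
rewrite {1}(row_sum_delta u) linear_sum; apply: eq_bigr => j _.
by rewrite linearZ /grad mxE mulrC.
Qed.

Definition continuously_differentiable X h : Prop :=
  (forall x, X x -> differentiable h x) /\
  (forall x, X x -> {for x, continuous (grad h)}).

Definition second_order_quotient h x u (t : R) : R :=
  2 * t ^- 2 * (h (x + t *: u) - h x - t * 'd h x u).

(* [cvg] takes place in R, so the limit is required to be finite. *)
Definition second_order_dir_differentiable h x u : Prop :=
  cvg (second_order_quotient h x u t @[t --> 0^'+]).

Definition second_order_dir_deriv h x u : R :=
  lim (second_order_quotient h x u t @[t --> 0^'+]).

End Differentiability.

Section Problem.
Context {R : realType} {s n m : nat}.
Variables (X : set 'rV[R]_s) (f : 'I_n -> 'rV[R]_s -> R)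
          (g : 'I_m -> 'rV[R]_s -> R).
Implicit Types x d : 'rV[R]_s.

Definition feasible : set 'rV[R]_s :=
  [set x | X x /\ forall j, g j x <= 0].

Definition weak_local_pareto_minimizer x : Prop :=
  feasible x /\
  exists2 U : set 'rV[R]_s, nbhs x U &
    ~ exists2 y, (U `&` feasible) y & forall i, f i y < f i x.

Definition active x : set 'I_m := [set j | g j x = 0].

Definition critical x d : Prop :=
  (forall i, 'd (f i) x d <= 0) /\
  (forall j, active x j -> 'd (g j) x d <= 0).

Definition critical_objectives x d : set 'I_n := [set i | 'd (f i) x d = 0].

Definition critical_constraints x d : set 'I_m :=
  [set j | active x j /\ 'd (g j) x d = 0].

End Problem.

(* Main.v *)
Require Import Defs.
From mathcomp Require Import all_boot all_order all_algebra.
From mathcomp Require Import boolp classical_sets reals topology normedtype derive.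
From mathcomp Require Import ring lra.
Import Order.TTheory GRing.Theory Num.Theory.
Import numFieldNormedType.Exports.
Local Open Scope ring_scope.
Local Open Scope classical_set_scope.

(** A solution z of the system would make the parabola
    t |-> x + t d + (t^2/2) z, with x the minimizer, run for small t > 0
    through feasible points at which every objective is smaller than at x.
    This contradicts weak minimality.

    The variation of a function h along the parabola splits into
    [h(x + t d + (t^2/2) z) - h(x + t d)] + [h(x + t d) - h(x)].
    By the mean value theorem the first bracket is t^2/2 times
    'd h xi z for some xi on a segment that shrinks to x, so it equals
    (t^2/2) ('d h x z + o(1)) because h is C^1 ([mean_value_parabola_cvg]).
    The second bracket is t 'd h x d + (t^2/2) (h''(x, d) + o(1)) when the
    second-order derivative exists, and t ('d h x d + o(1)) in any case.
    Hence h decreases when 'd h x d < 0, whatever z is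
    ([first_order_decrease]), and also when 'd h x d = 0 and
    'd h x z + h''(x, d) < 0 ([second_order_decrease]). Along a critical
    direction, every objective and every active constraint falls under one of
    these two cases; an inactive constraint stays negative by continuity.

    The C^1 hypothesis is what allows a curved path here: mere existence of
    h''(x, d) only gives information on the straight ray x + t d. *)

Lemma is_derive_line {R : realType} {V : normedModType R} {h : V -> R}
    {p z : V} {c : R} :
  differentiable h (p + c *: z) ->
  is_derive c 1 (fun r => h (p + r *: z)) ('d h (p + c *: z) z).
Proof.
move=> hdiff.
have quotientE : (fun k : R => k^-1 *: (((fun r => h (p + r *: z)) \o shift c)
      (k *: 1) - h (p + c *: z))) =
    (fun k : R => k^-1 *: ((h \o shift (p + c *: z)) (k *: z) - h (p + c *: z))).
  apply/funext => k /=; congr (_ *: (h _ - _)).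
  by rewrite [k%:A]mulr1 scalerDl addrCA.
split; first by rewrite /derivable quotientE; exact: diff_derivable.
by rewrite /derive quotientE -(deriveE _ hdiff).
Qed.

Lemma mean_value_line {R : realType} {V : normedModType R} {h : V -> R}
    {p z : V} {b : R} : 0 <= b ->
  (forall c, 0 <= c <= b -> differentiable h (p + c *: z)) ->
  exists2 c, 0 <= c <= b & h (p + b *: z) - h p = b * 'd h (p + c *: z) z.
Proof.
move=> b_ge0 hdiff.
have [||c] := @MVT_segment _ (fun r => h (p + r *: z))
  (fun c => 'd h (p + c *: z) z) 0 b b_ge0.
- move=> c /subset_itv_oo_cc; rewrite in_itv /= => /hdiff.
  exact: is_derive_line.
- apply: derivable_within_continuous => c; rewrite in_itv /= => /hdiff hc.
  by case: (is_derive_line hc).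
by rewrite in_itv /= scale0r addr0 subr0 mulrC => ? ?; exists c.
Qed.

(** Continuity of the gradient is only available as continuity of a row
    vector, and the differential in a fixed direction is a finite linear
    combination of its coordinates. *)
Lemma continuous_diff_direction {R : realType} {s : nat} {X : set 'rV[R]_s}
    {h : 'rV[R]_s -> R} {x : 'rV[R]_s} (z : 'rV[R]_s) :
  continuously_differentiable X h -> X x ->
  {for x, continuous (fun y => 'd h y z)}.
Proof.
move=> [_ grad_cont] Xx.
rewrite (_ : (fun y => _) = fun y => \sum_j grad h y 0 j * z 0 j); last first.
  by apply/funext => y; rewrite diff_gradE.
apply: (@cvg_big _ _ _ _ _ (@add_continuous _) _ (nbhs x)) => j _.
apply: cvgM; last exact: cvg_cst.
exact: (continuous_comp (grad_cont x Xx) (@coord_continuous _ _ _ 0 j _)).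
Qed.

(** The mean value theorem compares the parabola with its tangent ray, so it
    needs the whole segment joining the two, and not only its endpoints, to
    lie in a given neighbourhood. *)
Lemma near_parabola_segment {R : realType} {V : normedModType R}
    {x : V} (u z : V) {A : set V} : nbhs x A ->
  \forall t \near 0^'+, forall r : R, 0 <= r <= t ^+ 2 / 2 ->
    A (x + t *: u + r *: z).
Proof.
move=> /nbhs_ballP[e /= e_gt0 ballA].
have Cu : 0 <= `|u| := normr_ge0 u.
have Cz : 0 <= `|z| := normr_ge0 z.
near=> t => r /andP[r_ge0 r_le]; apply: ballA.
have t_gt0 : 0 < t by [].
have t_lt1 : t < 1 by near: t; exact: nbhs_right_lt.
(* The summand 1 keeps the divisor below positive when u = z = 0. *)
have t_small : t * (`|u| + `|z| + 1) < e.
  rewrite -ltr_pdivlMr; last lra.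
  by near: t; apply: nbhs_right_lt; rewrite divr_gt0//; lra.
rewrite -ball_normE /= -addrA distrC [x + _]addrC addrK.
apply: (le_lt_trans (ler_normD _ _)).
rewrite !normrZ (gtr0_norm t_gt0) (ger0_norm r_ge0).
(* r <= t^2/2 <= t since t < 1. *)
have : r * `|z| <= t * `|z| by apply: ler_wpM2r => //; nra.
lra.
Unshelve. all: by end_near. Qed.

(** Bending the ray x + t u into a parabola adds 'd h x z to its second-order
    quotient. The mean value theorem evaluates the differential at a point
    that differs from x, whence the need for a continuous gradient. *)
Lemma mean_value_parabola_cvg {R : realType} {s : nat} {X : set 'rV[R]_s}
    {h : 'rV[R]_s -> R} {x : 'rV[R]_s} (u z : 'rV[R]_s) :
  open X -> continuously_differentiable X h -> X x ->
  2 * t ^- 2 * (h (x + t *: u + (t ^+ 2 / 2) *: z) - h (x + t *: u))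
    @[t --> 0^'+] --> 'd h x z.
Proof.
move=> openX hC1 Xx; apply/cvgrPdist_lt => e e_gt0.
have near_diff : \forall y \near x, X y /\ `|'d h x z - 'd h y z| < e.
  apply: filterI; first exact: open_nbhs_nbhs.
  by move/cvgrPdist_lt: (continuous_diff_direction z hC1 Xx); apply.
near=> t.
have t_gt0 : 0 < t by [].
have seg : forall r, 0 <= r <= t ^+ 2 / 2 ->
    X (x + t *: u + r *: z) /\ `|'d h x z - 'd h (x + t *: u + r *: z) z| < e.
  by near: t; exact: near_parabola_segment near_diff.
have [||c /seg[_ dist_lt] ->] :=
  @mean_value_line _ _ h (x + t *: u) z (t ^+ 2 / 2).
- by rewrite divr_ge0// sqr_ge0.
- by move=> c /seg[Xc _]; apply: hC1.1.
rewrite (_ : 2 * t ^- 2 * (t ^+ 2 / 2 * _) =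
  'd h (x + t *: u + c *: z) z) //.
by field; rewrite gt_eqF.
Unshelve. all: by end_near. Qed.

(** The second-order quotient along the parabola tends to
    'd h x z + h''(x, u); as the first-order term vanishes, it has the sign of
    the increment of h. *)
Lemma second_order_decrease {R : realType} {s : nat} {X : set 'rV[R]_s}
    {h : 'rV[R]_s -> R} {x u : 'rV[R]_s} (z : 'rV[R]_s) :
  open X -> continuously_differentiable X h -> X x ->
  second_order_dir_differentiable h x u -> 'd h x u = 0 ->
  'd h x z + second_order_dir_deriv h x u < 0 ->
  \forall t \near 0^'+, h (x + t *: u + (t ^+ 2 / 2) *: z) < h x.
Proof.
move=> openX hC1 Xx h2 hu0 neg.
have sum_cvg := cvgD (mean_value_parabola_cvg u z openX hC1 Xx) h2.
near=> t.
have t_gt0 : 0 < t by [].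
have : 2 * t ^- 2 * (h (x + t *: u + (t ^+ 2 / 2) *: z) - h (x + t *: u)) +
    second_order_quotient h x u t < 0.
  by near: t; exact: cvgr_lt _ (sum_cvg _) _ neg.
rewrite /second_order_quotient hu0 mulr0 subr0 -mulrDr pmulr_rlt0.
  by rewrite addrA addrNK subr_lt0.
by rewrite mulr_gt0// invr_gt0 exprn_gt0.
Unshelve. all: by end_near. Qed.

(** After division by t, the correction coming from z is t/2 times a
    convergent quantity, so it vanishes in the limit and the linear term
    decides. *)
Lemma first_order_decrease {R : realType} {s : nat} {X : set 'rV[R]_s}
    {h : 'rV[R]_s -> R} {x u : 'rV[R]_s} (z : 'rV[R]_s) :
  open X -> continuously_differentiable X h -> X x -> 'd h x u < 0 ->
  \forall t \near 0^'+, h (x + t *: u + (t ^+ 2 / 2) *: z) < h x.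
Proof.
move=> openX hC1 Xx neg.
have hdiff := hC1.1 x Xx.
have line_cvg : t^-1 * (h (x + t *: u) - h x) @[t --> 0^'+] --> 'd h x u.
  apply: cvg_dnbhs_at_right; rewrite -(deriveE _ hdiff).
  under eq_fun do rewrite [x + _]addrC.
  exact: (diff_derivable (v := u) hdiff).
have half_cvg : t / 2 @[t --> (0 : R)^'+] --> (0 : R).
  apply: cvg_at_right_filter; rewrite -[X in _ --> X](mul0r (2^-1 : R)).
  by apply: cvgMr_tmp; exact: cvg_id.
have := cvgD (cvgM half_cvg (mean_value_parabola_cvg u z openX hC1 Xx)) line_cvg.
rewrite mul0r add0r => sum_cvg.
near=> t.
have t_gt0 : 0 < t by [].
have : t / 2 *
    (2 * t ^- 2 * (h (x + t *: u + (t ^+ 2 / 2) *: z) - h (x + t *: u))) +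
    t^-1 * (h (x + t *: u) - h x) < 0.
  by near: t; exact: cvgr_lt _ (sum_cvg _ _) _ neg.
rewrite (_ : _ + _ =
  t^-1 * (h (x + t *: u + (t ^+ 2 / 2) *: z) - h x)); last first.
  by field; rewrite gt_eqF.
by rewrite pmulr_rlt0 ?invr_gt0// subr_lt0.
Unshelve. all: by end_near. Qed.

Theorem theorem1 (R : realType) (s n m : nat) (X : set 'rV[R]_s)
    (f : 'I_n -> 'rV[R]_s -> R) (g : 'I_m -> 'rV[R]_s -> R)
    (xbar : 'rV[R]_s)
    (openX : open X)
    (xbar_min : weak_local_pareto_minimizer X f g xbar)
    (g_cont : forall j, ~ active g xbar j -> {for xbar, continuous (g j)})
    (f_C1 : forall i, continuously_differentiable X (f i))
    (g_C1 : forall j, active g xbar j -> continuously_differentiable X (g j))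
    (f_second : forall d, critical f g xbar d ->
       forall i, critical_objectives f xbar d i ->
         second_order_dir_differentiable (f i) xbar d)
    (g_second : forall d, critical f g xbar d ->
       forall j, critical_constraints g xbar d j ->
         second_order_dir_differentiable (g j) xbar d) :
  forall d, critical f g xbar d ->
    ~ exists z : 'rV[R]_s,
        (forall i, critical_objectives f xbar d i ->
           'd (f i) xbar z + second_order_dir_deriv (f i) xbar d < 0) /\
        (forall j, critical_constraints g xbar d j ->
           'd (g j) xbar z + second_order_dir_deriv (g j) xbar d < 0).
Proof.
move=> d d_crit [z [fz gz]].
have [[Xx gx] [U xU no_improvement]] := xbar_min.
pose y t := xbar + t *: d + (t ^+ 2 / 2) *: z.
have near_y (A : set 'rV[R]_s) : nbhs xbar A -> \forall t \near 0^'+, A (y t).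
  move=> /(near_parabola_segment d z); apply: filterS => t; apply.
  by rewrite lexx andbT divr_ge0 ?sqr_ge0.
have f_lt : \forall t \near 0^'+, forall i, f i (y t) < f i xbar.
  apply: filter_forall => i.
  have := d_crit.1 i; rewrite le_eqVlt => /orP[/eqP fd0|].
    apply: (second_order_decrease z openX) => //; first exact: f_second.
    exact: fz.
  exact: first_order_decrease openX (f_C1 i) Xx.
have g_le : \forall t \near 0^'+, forall j, g j (y t) <= 0.
  apply: filter_forall => j.
  have [gj0|gj0] := pselect (active g xbar j).
    suff : \forall t \near 0^'+, g j (y t) < g j xbar.
      by apply: filterS => t; rewrite gj0 => /ltW.
    have := d_crit.2 j gj0; rewrite le_eqVlt => /orP[/eqP gd0|].
      apply: (second_order_decrease z openX (g_C1 j gj0)) => //.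
        exact: g_second.
      exact: gz.
    exact: first_order_decrease openX (g_C1 j gj0) Xx.
  apply: (near_y [set x | g j x <= 0]); apply: cvgr_le _ (g_cont j gj0) _ _.
  by rewrite lt_neqAle gx andbT; apply/eqP.
have [t [f_t g_t X_t U_t]] : exists t,
    [/\ forall i, f i (y t) < f i xbar, forall j, g j (y t) <= 0, X (y t)
      & U (y t)].
  have X_near := near_y X (open_nbhs_nbhs (conj openX Xx)).
  apply: (@filter_ex _ ((0 : R)^'+)).
  near=> t; split; near: t => //; exact: near_y.
by apply: no_improvement; exists (y t).
Unshelve. all: by end_near. Qed.
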